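(* Let $(A,\circ)$ be a Novikov algebra, $(M,\cdot,l_A,r_A)$ an $A$-bimodule Novikov algebra and $\kappa,\lambda\in\mathbf k$ with $\kappa\neq0$. Let $\delta_+,\delta_-:M\to A$ be two linear maps and set $\alpha:=\frac{\delta_++\delta_-}{2}$, $\beta:=\frac{\delta_+-\delta_-}{2}$. Suppose that $\beta$ is balanced, $A$-invariant of mass $\kappa\neq 0$ and equivalent of mass $\lambda$. Then (in each item, for each choice of sign, the same sign being used throughout): (i) $(M_\pm,\cdot_\pm,l_A,r_A)$ are $A$-bimodule Novikov algebras, where $M_\pm=M$ as a vector space with the new Novikov algebra structure $$u\cdot_\pm v:=\lambda\,u\cdot v\mp2\,l_A(\beta(u))v,\qquad u,v\in M.$$ (ii) $\alpha$ is an extended $\mathcal O$-operator of weight $\lambda$ with extension $\beta$ of mass $(-1,\pm\lambda)$ on $(A,\circ)$ associated to $(M,\cdot,l_A,r_A)$ if and only if $\delta_\pm:M_\pm\to A$ is an $\mathcal O$-operator of weight $1$ on $(A,\circ)$ associated to $(M_\pm,\cdot_\pm,l_A,r_A)$.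
   Context: $\mathbf k$ is a field of characteristic zero; all vector spaces are finite-dimensional over $\mathbf k$. A Novikov algebra $(A,\circ)$ is a vector space with a bilinear operation satisfying $(a\circ b)\circ c-a\circ(b\circ c)=(b\circ a)\circ c-b\circ(a\circ c)$ and $(a\circ b)\circ c=(a\circ c)\circ b$ for all $a,b,c\in A$. A bimodule of a Novikov algebra $(A,\circ)$ is a triple $(V,l_A,r_A)$ with $V$ a vector space and $l_A,r_A:A\to\mathrm{End}_{\mathbf k}(V)$ linear such that for all $a,b\in A$, $v\in V$: $l_A(a\circ b-b\circ a)v=l_A(a)l_A(b)v-l_A(b)l_A(a)v$; $l_A(a)r_A(b)v-r_A(b)l_A(a)v=r_A(a\circ b)v-r_A(b)r_A(a)v$; $l_A(a\circ b)v=r_A(b)l_A(a)v$; $r_A(a)r_A(b)v=r_A(b)r_A(a)v$. An $A$-bimodule Novikov algebra is a quadruple $(M,\cdot,l_A,r_A)$ where $(M,\cdot)$ is a Novikov algebra, $(M,l_A,r_A)$ is a bimodule of $(A,\circ)$, and for all $a\in A$, $v,w\in M$: $(l_A(a)v)\cdot w-l_A(a)(v\cdot w)=(r_A(a)v)\cdot w-v\cdot(l_A(a)w)$; $r_A(a)(v\cdot w)-v\cdot(r_A(a)w)=r_A(a)(w\cdot v)-w\cdot(r_A(a)v)$; $(l_A(a)v)\cdot w=(l_A(a)w)\cdot v$; $r_A(a)(v\cdot w)=(r_A(a)v)\cdot w$. An $\mathcal O$-operator of weight $\lambda$ on $(A,\circ)$ associated to $(M,\cdot,l_A,r_A)$ is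 a linear map $\alpha:M\to A$ with $\alpha(u)\circ\alpha(v)=\alpha\big(l_A(\alpha(u))v+r_A(\alpha(v))u+\lambda\,u\cdot v\big)$ for all $u,v\in M$. Let $\beta:M\to A$ be linear and $\kappa,\mu\in\mathbf k$. $\beta$ is balanced if $l_A(\beta(u))v=r_A(\beta(v))u$ for all $u,v\in M$. $\beta$ is $A$-invariant of mass $\kappa$ if $\kappa\,(x\circ\beta(u))=\kappa\,\beta(l_A(x)u)$ and $\kappa\,(\beta(u)\circ x)=\kappa\,\beta(r_A(x)u)$ for all $x\in A,u\in M$. $\beta$ is equivalent of mass $\mu$ if $\mu\,l_A(\beta(u\cdot v))w=\mu\,(l_A(\beta(u))v)\cdot w$ and $\mu\,r_A(\beta(v\cdot w))u=\mu\,u\cdot(r_A(\beta(w))v)$ for all $u,v,w\in M$. $\alpha$ is an extended $\mathcal O$-operator of weight $\lambda$ with extension $\beta$ of mass $(\kappa,\mu)$ on $(A,\circ)$ associated to $(M,\cdot,l_A,r_A)$ if $\beta$ is balanced, $A$-invariant of mass $\kappa$ and equivalent of mass $\mu$, and for all $u,v\in M$: $\alpha(u)\circ\alpha(v)-\alpha\big(l_A(\alpha(u))v+r_A(\alpha(v))u+\lambda u\cdot v\big)=\kappa\,\beta(u)\circ\beta(v)+\mu\,\beta(u\cdot v)$. *)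

(* Defs.v *)
From HB Require Import structures.
From mathcomp Require Import all_boot all_order all_algebra.

Set Implicit Arguments.
Unset Strict Implicit.
Unset Printing Implicit Defensive.

Import GRing.Theory.
Local Open Scope ring_scope.

Section NovikovAlgebras.

Variables (k : fieldType) (A M : vectType k).

Record novikov (mul : A -> A -> A) : Prop := Novikov {
  nov_bilinear : bilinear_for *:%R *:%R mul;
  nov_left_sym : forall a b c,
    mul (mul a b) c - mul a (mul b c) = mul (mul b a) c - mul b (mul a c);
  nov_right_comm : forall a b c, mul (mul a b) c = mul (mul a c) b }.

Record novikov_bimodule (mulA : A -> A -> A) (l r : 'Hom(A, 'End(M))) : Prop :=
  NovikovBimodule {
  nbm_l_comm : forall a b v,
    l (mulA a b - mulA b a) v = l a (l b v) - l b (l a v);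
  nbm_lr_comm : forall a b v,
    l a (r b v) - r b (l a v) = r (mulA a b) v - r b (r a v);
  nbm_l_mul : forall a b v, l (mulA a b) v = r b (l a v);
  nbm_rr : forall a b v, r a (r b v) = r b (r a v) }.

End NovikovAlgebras.

Section Operators.

Variables (k : fieldType) (A M : vectType k).
Variables (mulA : A -> A -> A) (mulM : M -> M -> M) (l r : 'Hom(A, 'End(M))).

Record bimodule_novikov : Prop := BimoduleNovikov {
  bmn_novikov : novikov mulM;
  bmn_bimodule : novikov_bimodule mulA l r;
  bmn_left_sym : forall a v w,
    mulM (l a v) w - l a (mulM v w) = mulM (r a v) w - mulM v (l a w);
  bmn_right_sym : forall a v w,
    r a (mulM v w) - mulM v (r a w) = r a (mulM w v) - mulM w (r a v);
  bmn_l_comm : forall a v w, mulM (l a v) w = mulM (l a w) v;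
  bmn_r_mul : forall a v w, r a (mulM v w) = mulM (r a v) w }.

Definition O_operator (lambda : k) (alpha : 'Hom(M, A)) : Prop :=
  forall u v, mulA (alpha u) (alpha v)
    = alpha (l (alpha u) v + r (alpha v) u + lambda *: mulM u v).

Definition balanced (beta : 'Hom(M, A)) : Prop :=
  forall u v, l (beta u) v = r (beta v) u.

Definition invariant_of_mass (kappa : k) (beta : 'Hom(M, A)) : Prop :=
  forall x u, kappa *: mulA x (beta u) = kappa *: beta (l x u)
           /\ kappa *: mulA (beta u) x = kappa *: beta (r x u).

Definition equivalent_of_mass (mu : k) (beta : 'Hom(M, A)) : Prop :=
  forall u v w, mu *: l (beta (mulM u v)) w = mu *: mulM (l (beta u) v) w
             /\ mu *: r (beta (mulM v w)) u = mu *: mulM u (r (beta w) v).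

Record extended_O_operator (lambda kappa mu : k) (alpha beta : 'Hom(M, A)) :
  Prop := ExtendedOOperator {
  eO_balanced : balanced beta;
  eO_invariant : invariant_of_mass kappa beta;
  eO_equivalent : equivalent_of_mass mu beta;
  eO_eq : forall u v,
    mulA (alpha u) (alpha v)
      - alpha (l (alpha u) v + r (alpha v) u + lambda *: mulM u v)
    = kappa *: mulA (beta u) (beta v) + mu *: beta (mulM u v) }.

Definition mul_plus (lambda : k) (beta : 'Hom(M, A)) (u v : M) : M :=
  lambda *: mulM u v - 2%:R *: l (beta u) v.

Definition mul_minus (lambda : k) (beta : 'Hom(M, A)) (u v : M) : M :=
  lambda *: mulM u v + 2%:R *: l (beta u) v.

End Operators.

(* Main.v *)
Require Import Defs.
From HB Require Import structures.
From mathcomp Require Import all_boot all_order all_algebra.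

Set Implicit Arguments.
Unset Strict Implicit.
Unset Printing Implicit Defensive.

Import GRing.Theory.
Local Open Scope ring_scope.

(** Put [u # v := l (beta u) v]. Balance and invariance give
    [u # v = r (beta v) u] and [beta (u # v) = mulA (beta u) (beta v)], so [#]
    inherits all axioms of an [A]-bimodule Novikov algebra from the bimodule
    axioms evaluated on the image of [beta]. Equivalence says that the mixed
    associators of [lambda *: mulM] and [#] match up, so that every combination
    [lambda *: mulM + c *: #] is again Novikov. For (ii), write
    [delta = alpha + s *: beta] with [s = 1] or [s = -1]: the mixed terms
    [mulA (alpha u) (beta v)] cancel by invariance, and the terms
    [l (beta u) v + r (beta v) u = 2 *: (u # v)] are killed by the correction
    [- 2 s *: (u # v)] in the new product. *)

Lemma addrBACA (V : zmodType) (x y z t : V) :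
  (x + y) - (z + t) = (x - z) + (y - t).
Proof. by rewrite opprD addrACA. Qed.

Lemma subr_swap (V : zmodType) (x y z t : V) :
  x - y = z - t -> x - z = y - t.
Proof.
by move/(canRL (subrK _))->; rewrite addrAC [z - t - z]addrAC subrr
  add0r addrC.
Qed.

Section Bilinear.

Variables (k : nzRingType) (V : lmodType k) (mul : V -> V -> V).
Hypothesis bil : bilinear_for *:%R *:%R mul.

Lemma bilinear_mulDl x y z : mul (x + y) z = mul x z + mul y z.
Proof. by have := bil.1 z 1 x y; rewrite /= !scale1r. Qed.

Lemma bilinear_mulDr x y z : mul x (y + z) = mul x y + mul x z.
Proof. by have := bil.2 x 1 y z; rewrite /= !scale1r. Qed.

Lemma bilinear_mul0l z : mul 0 z = 0.
Proof. by apply: (addrI (mul 0 z)); rewrite -bilinear_mulDl !addr0. Qed.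

Lemma bilinear_mul0r z : mul z 0 = 0.
Proof. by apply: (addrI (mul z 0)); rewrite -bilinear_mulDr !addr0. Qed.

Lemma bilinear_mulZl c x z : mul (c *: x) z = c *: mul x z.
Proof. by have := bil.1 z c x 0; rewrite /= bilinear_mul0l !addr0. Qed.

Lemma bilinear_mulZr c x z : mul x (c *: z) = c *: mul x z.
Proof. by have := bil.2 x c z 0; rewrite /= bilinear_mul0r !addr0. Qed.

End Bilinear.

Section BimoduleNovikov.

Variables (k : fieldType) (A M : vectType k).
Variables (mulA : A -> A -> A) (l r : 'Hom(A, 'End(M))).

Lemma bimodule_novikovZ (p : M -> M -> M) (c : k) :
  bimodule_novikov mulA p l r ->
  bimodule_novikov mulA (fun u v => c *: p u v) l r.
Proof.
case=> -[bil ls rc] bim bl br lc rm.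
split=> //; first split; first split.
- move=> w a u v /=; rewrite (bilinear_mulDl bil) (bilinear_mulZl bil).
  by rewrite scalerDr !scalerA mulrC.
- move=> w a u v /=; rewrite (bilinear_mulDr bil) (bilinear_mulZr bil).
  by rewrite scalerDr !scalerA mulrC.
- move=> u v w; rewrite !(bilinear_mulZl bil) !(bilinear_mulZr bil).
  by rewrite -!scalerBr ls.
- by move=> u v w; rewrite !(bilinear_mulZl bil) rc.
- by move=> a v w; rewrite linearZ /= -!scalerBr bl.
- by move=> a v w; rewrite linearZ [r a (c *: p w v)]linearZ -!scalerBr br.
- by move=> a v w; rewrite lc.
- by move=> a v w; rewrite linearZ /= rm.
Qed.

(** The axioms relating the product to [l] and [r] are linear in the product, so they add up. The
    Novikov axioms are quadratic and produce cross terms. The first two compatibility conditions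
    make the two cross terms of each iterated product equal, so left symmetry and right
    commutativity need checking for only one of them. *)
Lemma bimodule_novikovD (p q mul : M -> M -> M) :
  bimodule_novikov mulA p l r -> bimodule_novikov mulA q l r ->
  (forall u v w, q (p u v) w = p (q u v) w) ->
  (forall u v w, q u (p v w) = p u (q v w)) ->
  (forall u v w, p (q u v) w - p u (q v w) = p (q v u) w - p v (q u w)) ->
  (forall u v w, p (q u v) w = p (q u w) v) ->
  (forall u v, mul u v = p u v + q u v) ->
  bimodule_novikov mulA mul l r.
Proof.
case=> -[pbil pls prc] bim pbl pbr plc prm.
case=> -[qbil qls qrc] _ qbl qbr qlc qrm.
move=> pql pqr pqls pqrc mulE.
have mulEl u v w : mul (mul u v) w =
    p (p u v) w + p (q u v) w + (p (q u v) w + q (q u v) w).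
  rewrite !mulE (bilinear_mulDl pbil) (bilinear_mulDl qbil).
  by rewrite pql.
have mulEr u v w : mul u (mul v w) =
    p u (p v w) + p u (q v w) + (p u (q v w) + q u (q v w)).
  rewrite !mulE (bilinear_mulDr pbil) (bilinear_mulDr qbil).
  by rewrite pqr.
split=> //; first split; first split.
- move=> w a u v /=; rewrite !mulE !(bilinear_mulDl pbil) !(bilinear_mulDl qbil).
  by rewrite (bilinear_mulZl pbil) (bilinear_mulZl qbil) scalerDr addrACA.
- move=> w a u v /=; rewrite !mulE !(bilinear_mulDr pbil) !(bilinear_mulDr qbil).
  by rewrite (bilinear_mulZr pbil) (bilinear_mulZr qbil) scalerDr addrACA.
- by move=> u v w; rewrite !mulEl !mulEr !addrBACA pls qls pqls.
- by move=> u v w; rewrite !mulEl prc qrc pqrc.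
- by move=> a v w; rewrite !mulE linearD /= !addrBACA pbl qbl.
- move=> a v w; rewrite !mulE (linearD (r a)).
  by rewrite [r a (p w v + _)]linearD !addrBACA pbr qbr.
- by move=> a v w; rewrite !mulE plc qlc.
- by move=> a v w; rewrite !mulE linearD /= prm qrm.
Qed.

Variable beta : 'Hom(M, A).
Hypothesis bim : novikov_bimodule mulA l r.
Hypothesis bal : balanced l r beta.
Hypothesis beta_l : forall x u, beta (l x u) = mulA x (beta u).
Hypothesis beta_r : forall x u, beta (r x u) = mulA (beta u) x.

Lemma balanced_bimodule_novikov :
  bimodule_novikov mulA (fun u v => l (beta u) v) l r.
Proof.
case: (bim) => lcomm lrcomm lmul rr.
(* The commutator axiom for [l], regrouped into the shape of left symmetry. *)
have lassoc a b v :
    l (mulA a b) v - l a (l b v) = l (mulA b a) v - l b (l a v).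
  by apply: subr_swap; rewrite -lcomm linearB add_lfunE opp_lfunE.
split=> //; first split; first split.
- by move=> w a u v; rewrite /= (linearP beta) (linearP l) add_lfunE scale_lfunE.
- by move=> w a u v; rewrite /= linearP.
- by move=> u v w; rewrite !beta_l lassoc.
- by move=> u v w; rewrite !beta_l lmul -bal beta_l.
- by move=> a v w; rewrite beta_l beta_r lassoc.
- move=> a v w.
  (* Up to sign, the left side is that of [nbm_lr_comm] at [beta v] and [a]. On the right side,
     balance turns both terms into values of [r] applied to [w]. *)
  by rewrite -[LHS]opprB lrcomm opprB (bal w v) (bal w) beta_r.
- by move=> a v w; rewrite !beta_l lmul -bal beta_l.
- by move=> a v w; rewrite beta_r lmul.
Qed.

Variables (mulM : M -> M -> M) (lambda : k).
Hypothesis equi : equivalent_of_mass mulM l r lambda beta.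

Lemma twisted_bimodule_novikov (c : k) (mul : M -> M -> M) :
  bimodule_novikov mulA mulM l r ->
  (forall u v, mul u v = lambda *: mulM u v + c *: l (beta u) v) ->
  bimodule_novikov mulA mul l r.
Proof.
move=> novM.
have [[bil _ _] _ bl _ lc _] := novM.
have lE u v w : lambda *: l (beta (mulM u v)) w =
    lambda *: mulM (l (beta u) v) w by case: (equi u v w).
(* Balance restates the second half of equivalence in terms of [l] alone. *)
have rE u v w : lambda *: l (beta u) (mulM v w) =
    lambda *: mulM u (l (beta v) w).
  by rewrite !bal; case: (equi u v w).
(* By [rE] this is [bmn_left_sym] at [a = beta u], where [r (beta u) v] is [l (beta v) u] by
   balance. *)
have symE u v w :
    lambda *: (mulM (l (beta u) v) w - mulM u (l (beta v) w)) =
    lambda *: (mulM (l (beta v) u) w - mulM v (l (beta u) w)).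
  by rewrite scalerBr -rE -!scalerBr bl -bal.
apply: (bimodule_novikovD (bimodule_novikovZ lambda novM)
  (bimodule_novikovZ c balanced_bimodule_novikov)) => u v w.
- rewrite (linearZZ beta) (linearZZ l) scale_lfunE /= lE.
  by rewrite (bilinear_mulZl bil) !scalerA mulrC.
- rewrite (linearZZ (l (beta u))) /= rE.
  by rewrite (bilinear_mulZr bil) !scalerA mulrC.
- rewrite !(bilinear_mulZl bil) !(bilinear_mulZr bil).
  by rewrite !scalerA mulrC -!scalerBr -!scalerA symE.
- by rewrite !(bilinear_mulZl bil) lc.
Qed.

(** The sign [s] covers both cases at once. The two equations have the same defect, so one holds
    exactly when the other does. *)
Lemma extended_O_operatorP (s : k) (alpha delta : 'Hom(M, A))
    (mul : M -> M -> M) :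
  novikov mulA -> s * s = 1 -> delta = alpha + s *: beta ->
  (forall u v, mul u v = lambda *: mulM u v - (s * 2%:R) *: l (beta u) v) ->
  extended_O_operator mulA mulM l r lambda (-1) (s * lambda) alpha beta <->
  O_operator mulA mul l r 1 delta.
Proof.
move=> [bil _ _] ss ->{delta} mulE.
have argE u v : l ((alpha + s *: beta) u) v + r ((alpha + s *: beta) v) u
      + 1 *: mul u v = l (alpha u) v + r (alpha v) u + lambda *: mulM u v.
  rewrite scale1r mulE !add_lfunE !scale_lfunE (linearD l) (linearD r) /=.
  rewrite (linearZZ l) (linearZZ r) /= !add_lfunE !scale_lfunE -bal.
  rewrite [X in X + _]addrACA -scalerDl -mulr2n -[s *+ 2]mulr_natr
    [lambda *: _ - _]addrC.
  by rewrite addrA addrK.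
(* The term [s * s *: mulA (beta u) (beta v)] with [s * s = 1] accounts for mass [-1], and
   [s *: beta (lambda *: mulM u v)] for mass [s * lambda]. *)
have deltaE u v :
    mulA ((alpha + s *: beta) u) ((alpha + s *: beta) v)
    - (alpha + s *: beta) (l (alpha u) v + r (alpha v) u + lambda *: mulM u v)
  = mulA (alpha u) (alpha v)
    - alpha (l (alpha u) v + r (alpha v) u + lambda *: mulM u v)
    - ((-1) *: mulA (beta u) (beta v) + (s * lambda) *: beta (mulM u v)).
  set a := l _ _ + _ + _.
  have betaE : s *: beta a = s *: mulA (alpha u) (beta v)
      + s *: mulA (beta u) (alpha v) + (s * lambda) *: beta (mulM u v).
    rewrite !(linearD beta) /= (linearZZ beta) /=.
    by rewrite beta_l beta_r !scalerDr scalerA.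
  rewrite !add_lfunE !scale_lfunE betaE.
  rewrite !(bilinear_mulDl bil) !(bilinear_mulDr bil).
  rewrite !(bilinear_mulZl bil) !(bilinear_mulZr bil).
  rewrite scalerA ss scale1r scaleN1r.
  rewrite [_ *: _ + mulA _ _]addrC addrACA.
  rewrite [alpha a + _]addrCA [X in _ - X]addrC.
  rewrite addrBACA subrr addr0 addrBACA.
  by rewrite opprD opprK.
split=> [[_ _ _ eO] u v | O].
  by apply/eqP; rewrite -subr_eq0 argE deltaE eO subrr.
split=> //.
(* [beta] is invariant without any scalar factor, hence of every mass, in particular [-1]. *)
- by move=> x u; rewrite beta_l beta_r.
- move=> u v w; have [lE rE] := equi u v w.
  by rewrite -!scalerA lE rE.
- move=> u v; apply/eqP; rewrite -subr_eq0 -deltaE -(argE u v).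
  by rewrite -O subrr.
Qed.

End BimoduleNovikov.

Theorem theorem2p25 (k : fieldType) (char0 : [pchar k] =i pred0)
    (A M : vectType k) (mulA : A -> A -> A) (mulM : M -> M -> M)
    (l r : 'Hom(A, 'End(M))) (kappa lambda : k)
    (novA : novikov mulA) (novM : bimodule_novikov mulA mulM l r)
    (kappa_neq0 : kappa != 0) (deltap deltam : 'Hom(M, A)) :
  let alpha : 'Hom(M, A) := 2%:R^-1 *: (deltap + deltam) in
  let beta : 'Hom(M, A) := 2%:R^-1 *: (deltap - deltam) in
  let mulp := mul_plus mulM l lambda beta in
  let mulm := mul_minus mulM l lambda beta in
  balanced l r beta ->
  invariant_of_mass mulA l r kappa beta ->
  equivalent_of_mass mulM l r lambda beta ->
  (bimodule_novikov mulA mulp l r /\ bimodule_novikov mulA mulm l r) /\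
  ((extended_O_operator mulA mulM l r lambda (-1) lambda alpha beta <->
      O_operator mulA mulp l r 1 deltap) /\
   (extended_O_operator mulA mulM l r lambda (-1) (- lambda) alpha beta <->
      O_operator mulA mulm l r 1 deltam)).
Proof.
move=> alpha beta mulp mulm bal inv equi.
have two_neq0 : 2%:R != 0 :> k by rewrite (pcharf0P k).1.
(* Cancelling [kappa] turns invariance of mass [kappa] into exact identities. *)
have beta_l x u : beta (l x u) = mulA x (beta u).
  by apply/esym/(scalerI kappa_neq0); case: (inv x u).
have beta_r x u : beta (r x u) = mulA (beta u) x.
  by apply/esym/(scalerI kappa_neq0); case: (inv x u).
have bim := bmn_bimodule novM.
have deltapE : deltap = alpha + 1 *: beta.
  rewrite scale1r -scalerDr addrACA subrr addr0 -mulr2n -scaler_nat.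
  by rewrite scalerA mulVf // scale1r.
have deltamE : deltam = alpha + (-1) *: beta.
  rewrite scaleN1r -scalerBr opprB [deltap + _]addrC addrACA subrr addr0.
  by rewrite -mulr2n -scaler_nat scalerA mulVf // scale1r.
split; split.
- apply: (twisted_bimodule_novikov bim bal beta_l beta_r equi
    (c := - 2%:R) novM).
  by move=> u v; rewrite scaleNr.
- exact: (twisted_bimodule_novikov bim bal beta_l beta_r equi
    (c := 2%:R) novM).
(* The mass [lambda] is read as [s * lambda] with [s = 1]; the last case takes [s = -1]. *)
- rewrite -[X in extended_O_operator _ _ _ _ _ _ X]mul1r.
  apply: extended_O_operatorP (mulr1 1) deltapE _ => // u v.
  by rewrite mul1r.
- rewrite -[- lambda]mulN1r.
  apply: extended_O_operatorP deltamE _ => // [|u v];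
    first by rewrite mulrNN mulr1.
  by rewrite mulN1r scaleNr opprK.
Qed.
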